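(* Let $\mathcal{A}=\{A_1,\ldots,A_m\}$ be a finite set of real $n\times n$ matrices and $\mathcal{A}^T=\{A_1^T,\ldots,A_m^T\}$. Let $G(N,E)$ be a path-complete graph, and let $G'(N,E')$ be its dual graph. Then $$\hat\rho_{\mathcal{V}^2,G}(\mathcal{A}^T)=\hat\rho_{\mathcal{V}^2,G'}(\mathcal{A}).$$
   Context: Words and graphs. The $m$ matrices are regarded as the letters of an alphabet. A word of length $k\ge 1$ is a formal sequence $A_{i_k}\cdots A_{i_1}$ of letters, read from right to left and identified with the corresponding matrix product. Graphs are finite directed graphs $G(N,E)$, $N\ne\emptyset$, with edges labeled by words; self-loops, and several edges with different labels between the same ordered pair of nodes, are allowed. When $G$ is used with $\mathcal{A}^T$, each letter $A_i$ in a label is replaced by $A_i^T$ (in the same order). Expanded graph and path-completeness. The expanded graph of $G$ is obtained by replacing every edge $i\to j$ whose label $A_{i_k}\cdots A_{i_1}$ has length $k>1$ by a path $i\to s_1\to\cdots\to s_{k-1}\to j$ through $k-1$ new nodes (new for each such edge), with consecutive edge labels $A_{i_1},\ldots,A_{i_k}$. $G$ is path-complete if for every word $A_{\sigma_k}\cdots A_{\sigma_1}$ of any length $k\ge1$ there is a directed path in the expanded graph with consecutive edge labels $A_{\sigma_1},\ldots,A_{\sigma_k}$. Dual graph. $G'(N,E')$ is obtained from $G$ by reversing the direction of all edges and replacing every label $A_{\sigma_k}\cdots A_{\sigma_1}$ by the reversed word $A_{\sigma_1}\cdots A_{\sigma_k}$. Bounds. $\mathcal{V}^2$ is the class of positive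 definite quadratic forms $x^TPx$, $P\succ0$. $\hat\rho_{\mathcal{V}^2,G}(\mathcal{A})$ is the infimum of $1/\gamma$ over all $\gamma>0$ for which there are symmetric positive definite matrices $P_i$, $i\in N$, with $\gamma^{2|L|}L^TP_jL\preceq P_i$ for every edge of $G$ from $i$ to $j$ with label $L$, where $|L|$ is the length of the word $L$. *)

(* Defs.v *)
From HB Require Import structures.
From mathcomp Require Import all_boot all_order all_algebra finmap.
From mathcomp Require Import classical_sets reals.

Set Implicit Arguments.
Unset Strict Implicit.
Unset Printing Implicit Defensive.

Import Order.TTheory GRing.Theory Num.Theory.

Local Open Scope ring_scope.

(* The letters A_1, ..., A_m are the indices 'I_m. A word is listed as it is
   written: A_{i_k} ... A_{i_1} is [:: i_k; ...; i_1], so that the list order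
   is the order of the matrix product and [rev w] is the reading order. *)
Definition word (m : nat) := seq 'I_m.

Definition word_mx (R : realType) (n m : nat) (A : 'I_m -> 'M[R]_n)
  (w : word m) : 'M[R]_n := \prod_(a <- w) A a.

(* An edge (i, w, j) goes from i to j with label w. *)
Definition edge (m : nat) (N : choiceType) := (N * word m * N)%type.
Definition esrc m (N : choiceType) (e : edge m N) : N := e.1.1.
Definition elabel m (N : choiceType) (e : edge m N) : word m := e.1.2.
Definition etgt m (N : choiceType) (e : edge m N) : N := e.2.

Record lgraph (m : nat) (N : finType) := LGraph {
  edges : {fset edge m N};
  nodes_neq0 : (0 < #|N|)%N;
  labels_neq0 : forall e, e \in edges -> (0 < size (elabel e))%N
}.

Section Expanded.
Variables (m : nat) (N : finType) (G : lgraph m N).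

(* An edge whose label has length k contributes k.-1 new nodes:
   [inr (existT _ e t)] is the node s_{t+1} of the edge e. *)
Definition xnode : finType :=
  (N + {e : edges G & 'I_(size (elabel (val e))).-1})%type.

(* The t-th node (t = 0, ..., k) of the path i -> s_1 -> ... -> s_{k-1} -> j
   replacing the edge e; [insub] fails exactly at the endpoint t = k. *)
Definition xpos (e : edges G) (t : nat) : xnode :=
  if t is t'.+1 then
    if insub t' is Some s then
      inr (existT (fun e : edges G => 'I_(size (elabel (val e))).-1) e s)
    else inl (etgt (val e))
  else inl (esrc (val e)).

Definition xedge (p : {e : edges G & 'I_(size (elabel (val e)))}) :
    edge m xnode :=
  let e := tag p in let t := tagged p in
  (xpos e t, [:: tnth (in_tuple (elabel (val e))) (rev_ord t)], xpos e t.+1).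

Definition xedges : {fset edge m xnode} :=
  [fset xedge p | p in {: {e : edges G & 'I_(size (elabel (val e)))}}]%fset.

Lemma xnodes_neq0 : (0 < #|xnode|)%N.
Proof. by rewrite card_sum ltn_addr // (nodes_neq0 G). Qed.

Lemma xlabels_neq0 e : e \in xedges -> (0 < size (elabel e))%N.
Proof. by move=> /imfsetP[p _ ->]. Qed.

Definition expanded : lgraph m xnode := LGraph xnodes_neq0 xlabels_neq0.

End Expanded.

Definition walk (m : nat) (N : finType) (G : lgraph m N)
  (es : seq (edge m N)) : Prop :=
  {subset es <= edges G} /\ sorted (fun e f => etgt e == esrc f) es.

Definition path_complete (m : nat) (N : finType) (G : lgraph m N) : Prop :=
  forall w : word m, (0 < size w)%N ->
    exists es : seq (edge m (xnode G)),
      walk (expanded G) es /\ map (@elabel _ _) es = [seq [:: a] | a <- rev w].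

Section Dual.
Variables (m : nat) (N : finType).

Definition dual_edge (e : edge m N) : edge m N :=
  (etgt e, rev (elabel e), esrc e).

Variable G : lgraph m N.

Definition dual_edges : {fset edge m N} :=
  [fset dual_edge e | e in edges G]%fset.

Lemma dual_labels_neq0 e : e \in dual_edges -> (0 < size (elabel e))%N.
Proof.
by move=> /imfsetP[f /= fG ->]; rewrite /elabel /= size_rev (labels_neq0 fG).
Qed.

Definition dual : lgraph m N := LGraph (nodes_neq0 G) dual_labels_neq0.

End Dual.

Section Bound.
Variables (R : realType) (n : nat).

Definition qform (P : 'M[R]_n) (x : 'cV[R]_n) : R :=
  (x^T *m P *m x) ord0 ord0.

Definition posdef (P : 'M[R]_n) : Prop :=
  P^T = P /\ forall x : 'cV[R]_n, x != 0 -> 0 < qform P x.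

Definition loewner_le (P Q : 'M[R]_n) : Prop :=
  forall x : 'cV[R]_n, qform P x <= qform Q x.

Definition feasible (m : nat) (A : 'I_m -> 'M[R]_n) (N : finType)
    (G : lgraph m N) (gamma : R) : Prop :=
  exists P : N -> 'M[R]_n,
    (forall i, posdef (P i)) /\
    forall e, e \in edges G ->
      let L := word_mx A (elabel e) in
      loewner_le (gamma ^+ (2 * size (elabel e)) *: (L^T *m P (etgt e) *m L))
                 (P (esrc e)).

(* The set is bounded below by 0, and nonempty because the identity matrices
   are feasible for small gamma, so [inf] takes no default value here. *)
Definition rho_hat (m : nat) (A : 'I_m -> 'M[R]_n) (N : finType)
    (G : lgraph m N) : R :=
  inf [set gamma^-1 | gamma in
        [set gamma : R | 0 < gamma /\ feasible A G gamma]]%classic.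

End Bound.

(* Main.v *)
Require Import Defs.
From mathcomp Require Import all_boot all_order all_algebra finmap.
From mathcomp Require Import boolp classical_sets reals.

(** Both bounds are infima over the same set: a rate [gamma] is feasible for
    the transposed matrices on a graph iff it is feasible for the original
    matrices on the dual graph, because inverting the certificate [P] turns one
    family of inequalities into the other.

    Transposing a product reverses it, so an edge from [i] to [j] with label [w]
    asks that [c M P_j M^T <= P_i], where [M] is the product along [rev w] and
    [c] is a power of [gamma]. Its dual edge goes from [j] to [i] with label
    [rev w] and asks that [c M^T Q_i M <= Q_j]. For [Q_k = P_k^-1] these two
    conditions are equivalent: this is the duality [loewner_le_invmx], the two
    Schur complement readings of one block matrix, proved here by completing a
    square. *)

Import Order.TTheory GRing.Theory Num.Theory.

Local Open Scope ring_scope.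

Lemma qform_ge0 {R : realType} {n : nat} {P : 'M[R]_n} :
  posdef P -> forall x, 0 <= qform P x.
Proof.
move=> [_ Ppos] x; have [->|x0] := eqVneq x 0; last exact/ltW/Ppos.
by rewrite /qform mulmx0 mxE.
Qed.

Lemma qform_congr {R : realType} {p n : nat} (P : 'M[R]_p) (L : 'M[R]_(p, n)) x :
  qform (L^T *m P *m L) x = qform P (L *m x).
Proof. by rewrite /qform trmx_mul !mulmxA. Qed.

Lemma qformZl {R : realType} {n : nat} (c : R) (P : 'M[R]_n) x :
  qform (c *: P) x = c * qform P x.
Proof. by rewrite /qform -scalemxAr -scalemxAl mxE. Qed.

Lemma qformZr {R : realType} {n : nat} (c : R) (P : 'M[R]_n) x :
  qform P (c *: x) = c ^+ 2 * qform P x.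
Proof.
have trZ : (c *: x)^T = c *: x^T by rewrite linearZ.
by rewrite /qform trZ -!scalemxAl -scalemxAr scalerA mxE expr2.
Qed.

Lemma qformB {R : realType} {n : nat} {P : 'M[R]_n} : P^T = P ->
  forall x y, qform P (x - y) =
    qform P x - (x^T *m P *m y) ord0 ord0 *+ 2 + qform P y.
Proof.
move=> symP x y.
have crossE : (y^T *m P *m x) ord0 ord0 = (x^T *m P *m y) ord0 ord0.
  by rewrite -[y^T *m P *m x]trmxK mxE !trmx_mul trmxK symP mulmxA.
rewrite /qform (linearB (@trmx R n 1)) /= !mulmxBl !mulmxBr.
move: crossE; rewrite !mxE => ->.
by rewrite opprB mulr2n opprD !addrA addrAC.
Qed.

Lemma posdef_unitmx {R : realType} {n : nat} {P : 'M[R]_n} :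
  posdef P -> P \in unitmx.
Proof.
move=> [_ Ppos]; rewrite -row_free_unit -kermx_eq0.
apply/negPn/negP => /rowV0Pn[u /sub_kermxP uP0 u0].
have := Ppos u^T; rewrite trmx_eq0 /qform trmxK uP0 mul0mx mxE ltxx.
by move=> /(_ u0).
Qed.

Lemma qform_invmx {R : realType} {n : nat} {P : 'M[R]_n} :
  posdef P -> forall x, qform (invmx P) x = qform P (invmx P *m x).
Proof.
move=> Ppd x; have [symP _] := Ppd; have Pu := posdef_unitmx Ppd.
by rewrite -qform_congr trmx_inv symP mulVmx // mul1mx.
Qed.

Lemma posdef_invmx {R : realType} {n : nat} {P : 'M[R]_n} :
  posdef P -> posdef (invmx P).
Proof.
move=> Ppd; have [symP Ppos] := Ppd; split=> [|x x0].
  by rewrite trmx_inv symP.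
rewrite qform_invmx //; apply: Ppos; apply: contra_neq x0 => Px0.
by rewrite -[x](mulKVmx (posdef_unitmx Ppd)) Px0 mulmx0.
Qed.

(** With [y = Q^-1 L^T x] the number [c x^T L y] is the left-hand form at [x],
    and also [c] times [qform Q y]. Expanding
    [0 <= qform P (P^-1 x - c L y)] and bounding its last term by the hypothesis
    at [y] leaves [0 <= qform P^-1 x - c x^T L y]. *)
Lemma loewner_le_invmx {R : realType} {p n : nat} {c : R}
    {L : 'M[R]_(p, n)} {P : 'M[R]_p} {Q : 'M[R]_n} :
  0 <= c -> posdef P -> posdef Q ->
  loewner_le (c *: (L^T *m P *m L)) Q ->
  loewner_le (c *: (L *m invmx Q *m L^T)) (invmx P).
Proof.
move=> c0 Ppd Qpd leQ x; have Pu := posdef_unitmx Ppd.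
have [symP _] := Ppd.
rewrite qformZl -{1}[L]trmxK qform_congr qform_invmx //.
set y := invmx Q *m _.
have qQy : qform Q y = (x^T *m L *m y) ord0 ord0.
  by rewrite -qform_invmx // /qform /y trmx_mul trmxK !mulmxA.
have := qform_ge0 Ppd (invmx P *m x - c *: (L *m y)).
rewrite (qformB symP) -qform_invmx //.
have -> : ((invmx P *m x)^T *m P *m (c *: (L *m y))) ord0 ord0 = c * qform Q y.
  by rewrite qQy trmx_mul trmx_inv symP mulmxKV // -scalemxAr mxE mulmxA.
have -> : qform P (c *: (L *m y)) = c * qform (c *: (L^T *m P *m L)) y.
  by rewrite qformZr qformZl qform_congr expr2 mulrA.
move=> /le_trans/(_ (lerD (lexx _) (ler_wpM2l c0 (leQ y)))).
by rewrite mulr2n opprD addrA subrK subr_ge0.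
Qed.

Lemma word_mx_trmx {R : realType} {n m : nat} (A : 'I_m -> 'M[R]_n) (w : word m) :
  word_mx (fun i => (A i)^T) w = (word_mx A (rev w))^T.
Proof.
rewrite /word_mx; elim: w => [|a w IHw]; first by rewrite !big_nil trmx1.
by rewrite big_cons IHw rev_cons -cats1 big_cat big_seq1 /= trmx_mul.
Qed.

(** The inverses of a certificate for one side certify the other, edge by
    edge; the scalar is the same on both sides because an edge and its dual
    carry labels of equal length. *)
Lemma feasible_dual {R : realType} {n m : nat} (A : 'I_m -> 'M[R]_n)
    {N : finType} (G : lgraph m N) (gamma : R) : 0 < gamma ->
  feasible (fun i => (A i)^T) G gamma <-> feasible A (dual G) gamma.
Proof.
move=> gamma0; have gX0 k : 0 <= gamma ^+ k by exact/exprn_ge0/ltW.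
split=> -[P [Ppd Pedge]]; exists (fun i => invmx (P i));
  split=> [i|e eG L]; try exact: posdef_invmx.
- move: eG @L => /imfsetP[f /= fG ->] /=.
  have := Pedge f fG; rewrite word_mx_trmx => /(loewner_le_invmx (gX0 _)).
  by rewrite /elabel /esrc /etgt /= size_rev trmxK; apply.
- have := Pedge (dual_edge e) (in_imfset _ _ eG).
  rewrite [elabel _]/= size_rev => /(loewner_le_invmx (gX0 _)).
  by rewrite /L word_mx_trmx trmxK; apply.
Qed.

Theorem theorem5p1 (R : realType) (n m : nat) (A : 'I_m -> 'M[R]_n)
  (N : finType) (G : lgraph m N) (hG : path_complete G) :
  rho_hat (fun i => (A i)^T) G = rho_hat A (dual G).
Proof.
rewrite /rho_hat; congr (inf (image _ _)); apply/funext => gamma.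
by apply/propext; split=> -[gamma0 /(feasible_dual A G gamma gamma0)].
Qed.
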